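(* Let $0<L\le M$ and let $Q$ be the $Y$-network: a vertex $v$ incident to three arcs of lengths $1$, $L$ (the left arc) and $M$ (the right arc), with root $O$ the other endpoint of the arc of length $1$. Put $M'=\min\{M,\sqrt{L(L+2)}\}$ and $D=L(L+2)+M'(M'+2)$. Then the randomized expanding competitive ratio of $Q$ is $$\rho(Q)=V:=1+\frac{2LM'}{L(L+2)+M'(M'+2)} .$$ Moreover, the following randomized expanding search is optimal (its randomized competitive ratio equals $V$): first search the arc of length $1$, then follow one of the strategies below, chosen with the indicated probability. (A) With probability $2M'/D$: search the left arc from $v$, then the right arc from $v$. (B) With probability $(L^2+2L-M'^2)/D$: search the right arc from $v$ up to length $M'$, then the whole left arc, then the remainder of the right arc. (C) With probability $2L^2/D$: search the left and right arcs simultaneously, at speeds $L/(L+M')$ and $M'/(L+M')$ respectively, until the whole left arc (and length $M'$ of the right arc) has been searched, then search the remainder of the right arc. (D) With probability $(2M'^2-2L^2)/D$: choose $U$ uniformly at random in $[0,M']$, search the right arc from $v$ up to length $U$, then the whole left arc, then the remainder of the right arc.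
   Context: For a network $Q$ (finite connected metric graph) with root $O$ and length measure $\lambda$, with total measure $\mu=\lambda(Q)$, $d(x)$ is the length of a shortest path from $O$ to $x$. An expanding search is a family of connected subsets $S(t)\subset Q$, $0\le t\le\mu$, with $S(0)=\{O\}$, $S(t)\subset S(t')$ for $t\le t'$, and $\lambda(S(t))=t$ for all $t$. The search time of $H\in Q$ is $T(S,H)=\min\{t: H\in S(t)\}$; the normalized search time is $\hat T(S,H)=T(S,H)/d(H)$ for $H\ne O$, and $\hat T(S,O)=0$. A randomized search $s$ is a probability distribution over expanding searches; $\hat T(s,H)$ is the expected normalized search time; the randomized competitive ratio of $s$ is $\rho_s(Q)=\sup_{H\in Q}\hat T(s,H)$ and $\rho(Q)=\inf_s\rho_s(Q)$. The search $s$ is optimal if $\rho_s(Q)=\rho(Q)$. *)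

(* Defs.v *)
From HB Require Import structures.
From mathcomp Require Import all_boot all_order all_algebra.
From mathcomp Require Import all_classical all_reals all_analysis.
Import Order.TTheory GRing.Theory Num.Theory.
Import numFieldNormedType.Exports.

Set Implicit Arguments.
Unset Strict Implicit.
Unset Printing Implicit Defensive.

Local Open Scope classical_set_scope.
Local Open Scope ring_scope.

(* The combinatorial data of a network: a finite connected multigraph (loops
   and parallel arcs allowed) with arcs of positive length and a root vertex. *)
Record network (R : realType) := Network {
  vertex : finType ;
  net_arc : finType ;
  src : net_arc -> vertex ;
  tgt : net_arc -> vertex ;
  len : net_arc -> R ;
  net_root : vertex ;
  len_gt0 : forall e, 0 < len e ;
  network_connected : forall u w : vertex,
    connect [rel x y | [exists e, ((src e == x) && (tgt e == y))
                               || ((src e == y) && (tgt e == x))]] u w }.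

Section Points.
Context {R : realType} (N : network R).

(* The points of the metric graph: the vertices, and the interior points of
   the arcs, parametrized by their distance along the arc from its source. *)
Inductive netpoint :=
  | Vertex of vertex N
  | Inner (e : net_arc N) (t : R) of 0 < t < len e.

HB.instance Definition _ := gen_eqMixin netpoint.
HB.instance Definition _ := gen_choiceMixin netpoint.

(* Arc-length parametrization of e, extended to be constant outside
   `[0, len e]. *)
Definition arcpt (e : net_arc N) (t : R) : netpoint :=
  match boolP (0 < t < len e) with
  | AltTrue h => Inner h
  | AltFalse _ => Vertex (if t <= 0 then src e else tgt e)
  end.

(* The topology of the metric graph is the final topology for the arc
   parametrizations. Since arcpt e factors through the retraction of R onto
   `[0, len e], openness of the preimage in R is the same as relative openness
   in `[0, len e]. *)
Definition point_open : set_system netpoint :=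
  [set U | forall e : net_arc N, open (arcpt e @^-1` U)].

Lemma point_openT : point_open setT.
Proof. by move=> e; rewrite preimage_setT; exact: openT. Qed.

Lemma point_openI : setI_closed point_open.
Proof. by move=> A B oA oB e; rewrite preimage_setI; exact: openI. Qed.

Lemma point_open_bigU (I : Type) (f : I -> set netpoint) :
  (forall i, point_open (f i)) -> point_open (\bigcup_i f i).
Proof.
by move=> of_ e; rewrite preimage_bigcup; apply: bigcup_open => i _; exact: of_.
Qed.

HB.instance Definition _ :=
  isOpenTopological.Build netpoint point_openT point_openI point_open_bigU.

Definition origin : netpoint := Vertex (net_root N).

Definition length_measure (A : set netpoint) : \bar R :=
  (\sum_(e : net_arc N)
     lebesgue_measure (`[0%R, len e]%classic `&` arcpt e @^-1` A))%E.

(* A walk is a sequence of arcs, each traversed forwards (true) or backwards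
   (false). *)
Definition step_src (a : net_arc N * bool) := if a.2 then src a.1 else tgt a.1.
Definition step_tgt (a : net_arc N * bool) := if a.2 then tgt a.1 else src a.1.

Fixpoint net_walk (x : vertex N) (p : seq (net_arc N * bool)) (y : vertex N) :
    bool :=
  if p is a :: p' then (step_src a == x) && net_walk (step_tgt a) p' y
  else x == y.

Definition vertex_dist (x y : vertex N) : R :=
  inf [set \sum_(a <- p) len a.1 | p in [set p | net_walk x p y]].

(* A shortest path from the root to an interior point of an arc enters that arc
   through one of its two ends. *)
Definition root_dist (x : netpoint) : R :=
  match x with
  | Vertex u => vertex_dist (net_root N) u
  | Inner e t _ => Num.min (vertex_dist (net_root N) (src e) + t)
                           (vertex_dist (net_root N) (tgt e) + (len e - t))
  end.

(* The values of a search outside the time interval [0, mu] are irrelevant. *)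
Record expanding_search := ExpandingSearch {
  searched :> R -> set netpoint ;
  searched0 : searched 0 = [set origin] ;
  searched_connected : forall t, 0 <= t ->
    (t%:E <= length_measure setT)%E -> connected (searched t) ;
  searched_mono : forall t t', 0 <= t -> t <= t' ->
    (t'%:E <= length_measure setT)%E -> searched t `<=` searched t' ;
  searched_length : forall t, 0 <= t ->
    (t%:E <= length_measure setT)%E -> length_measure (searched t) = t%:E }.

(* The infimum is the minimum whenever the latter exists; it is +oo if H is
   never searched. *)
Definition search_time (S : expanding_search) (H : netpoint) : \bar R :=
  ereal_inf [set t%:E | t in
    [set t : R | [/\ 0 <= t, (t%:E <= length_measure setT)%E & S t H]]].

Definition normalized_time (S : expanding_search) (H : netpoint) : \bar R :=
  if H == origin then 0%E else (search_time S H * (root_dist H)^-1%:E)%E.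

(* Probabilities live on the sigma-algebra generated by the search times.
   The type of measurable spaces also asks for a distinguished element of the
   carrier; S0 provides it and plays no other role. *)
Definition searches (S0 : expanding_search) : Type := expanding_search.

HB.instance Definition _ S0 := gen_eqMixin (searches S0).
HB.instance Definition _ S0 := gen_choiceMixin (searches S0).
HB.instance Definition _ S0 := isPointed.Build (searches S0) S0.

Definition search_events (S0 : expanding_search) : set (set (searches S0)) :=
  [set A | exists (H : netpoint) (t : R),
     A = [set S : searches S0 | (search_time S H <= t%:E)%E]].

Definition search_space (S0 : expanding_search) :=
  g_sigma_algebraType (@search_events S0).

Record randomized_search := RandomizedSearch {
  base_search : expanding_search ;
  law :> probability (search_space base_search) R }.

Definition expected_normalized_time (s : randomized_search) (H : netpoint) :
    \bar R :=
  (\int[law s]_(S in [set: search_space (base_search s)])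
     normalized_time S H)%E.

Definition randomized_ratio (s : randomized_search) : \bar R :=
  ereal_sup [set expected_normalized_time s H | H in [set: netpoint]].

Definition competitive_ratio : \bar R :=
  ereal_inf [set randomized_ratio s | s in [set: randomized_search]].

Definition optimal_search (s : randomized_search) : Prop :=
  randomized_ratio s = competitive_ratio.

End Points.

Inductive Yvertex := YRoot | YCenter | YLeft | YRight.
Inductive Yarc := Stem | LeftArc | RightArc.

Definition Yvertex_code v :=
  match v with
  | YRoot => (true, true) | YCenter => (true, false)
  | YLeft => (false, true) | YRight => (false, false)
  end.
Definition Yvertex_decode c :=
  match c with
  | (true, true) => YRoot | (true, false) => YCenter
  | (false, true) => YLeft | (false, false) => YRight
  end.
Lemma Yvertex_codeK : cancel Yvertex_code Yvertex_decode.
Proof. by case. Qed.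

HB.instance Definition _ := Finite.copy Yvertex (can_type Yvertex_codeK).

Definition Yarc_code e :=
  match e with
  | Stem => None | LeftArc => Some true | RightArc => Some false
  end.
Definition Yarc_decode c :=
  match c with
  | None => Stem | Some true => LeftArc | Some false => RightArc
  end.
Lemma Yarc_codeK : cancel Yarc_code Yarc_decode.
Proof. by case. Qed.

HB.instance Definition _ := Finite.copy Yarc (can_type Yarc_codeK).

Definition Ysrc e := if e is Stem then YRoot else YCenter.
Definition Ytgt e :=
  match e with
  | Stem => YCenter | LeftArc => YLeft | RightArc => YRight
  end.

Lemma Y_connected (u w : Yvertex) :
  connect [rel x y | [exists e, ((Ysrc e == x) && (Ytgt e == y))
                             || ((Ysrc e == y) && (Ytgt e == x))]] u w.
Proof.
set r := (X in connect X).
have rsym : symmetric r by move=> x y; apply: eq_existsb => e /=; rewrite orbC.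
have toC x : connect r x YCenter.
  have [->//|] := eqVneq x YCenter; case: x => // _; apply: connect1.
  - by apply/existsP; exists Stem.
  - by apply/existsP; exists LeftArc.
  - by apply/existsP; exists RightArc.
by apply: connect_trans (toC u) _; rewrite (sym_connect_sym rsym).
Qed.

Section Y.
Context {R : realType} (L M : R) (L_gt0 : 0 < L) (LM : L <= M).

Definition Ylen e :=
  match e with Stem => 1 | LeftArc => L | RightArc => M end.

Lemma Ylen_gt0 e : 0 < Ylen e.
Proof. by case: e => //=; exact: lt_le_trans LM. Qed.

Definition Ynet : network R := Network YRoot Ylen_gt0 Y_connected.

(* S first searches the stem and then, at time tau later, has searched length
   left tau of the left arc and the remaining tau - left tau of the right arc,
   both measured from the centre. *)
Definition follows (S : expanding_search Ynet) (left : R -> R) : Prop :=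
  (forall t, 0 <= t <= 1 -> S t = @arcpt R Ynet Stem @` `[0, t]) /\
  (forall tau, 0 <= tau <= L + M ->
     S (1 + tau) = @arcpt R Ynet Stem @` `[0, 1]
               `|` @arcpt R Ynet LeftArc @` `[0, left tau]
               `|` @arcpt R Ynet RightArc @` `[0, tau - left tau]).

Definition left_then_right : R -> R := fun tau => Num.min tau L.

(* First the right arc up to length u, next the whole left arc, then the rest
   of the right arc. *)
Definition right_left_right (u : R) : R -> R :=
  fun tau => Num.min (Num.max (tau - u) 0) L.

(* The left and right arcs at speeds L / (L + m) and m / (L + m) up to time
   L + m, then the rest of the right arc. *)
Definition simultaneous (m : R) : R -> R :=
  fun tau => Num.min tau (L + m) * (L / (L + m)).

Definition Mclip : R := Num.min M (Num.sqrt (L * (L + 2))).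

Lemma Mclip_gt0 : 0 < Mclip.
Proof.
rewrite /Mclip lt_min (lt_le_trans L_gt0 LM) sqrtr_gt0 mulr_gt0 //.
by rewrite addr_gt0.
Qed.

End Y.

(* Main.v *)
Require Import Defs.
From HB Require Import structures.
From mathcomp Require Import all_boot all_order all_algebra.
From mathcomp Require Import all_classical all_reals all_analysis.
From mathcomp Require Import measurable_realfun ring lra.
Import Order.TTheory GRing.Theory Num.Theory.
Import numFieldNormedType.Exports.

Local Open Scope classical_set_scope.
Local Open Scope ring_scope.

Set Implicit Arguments.
Unset Strict Implicit.
Unset Printing Implicit Defensive.

(** Write m for the clipped length of the right arm, D = L(L+2) + m(m+2) and
    V = 1 + 2Lm/D. A point at depth d = 1 + x is found no earlier than at time
    d, and the excess over d is the time spent on the other arm.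

    Upper bound ([strategy_ratio_le]). The four probabilities are chosen so that
    the expected excess equals (2Lm/D) d at every point of the left arm
    ([expected_time_left]) and at every point of the right arm within distance m
    of the centre ([expected_time_right]); under (A), (B), (C) and (D) the
    excess is 0, m, m(x/L) and U at distance x on the left arm, and L, 0, L(y/m)
    and L if U < y (else 0) at distance y <= m on the right arm. A point of
    the right arm beyond m exists only if m^2 = L(L+2); then strategy (B) has
    probability 0, the excess is always L, and D = 2m(m+1) makes L at most
    (2Lm/D) d.

    Lower bound ([randomized_ratio_ge]). Spread hiding points evenly, in length,
    over the left arm and the first m units of the right arm, and weight each by
    its depth; the total weight tends to D/2. A search must cross the stem
    before it gains anything on the two arms, and then gains length at rate at
    most 1, so the sum of the search times is at least that of a segment of length
    L + m scanned from time 1 on, namely (L+m) + (L+m)^2/2 = V D/2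
    ([sum_grid_time_ge]). Averaging over the randomized search gives a ratio of
    at least V. A finite grid of hiding points is used, with mesh tending to 0,
    so that only a finite sum has to be exchanged with the expectation: the
    sigma-algebra on searches makes each search time measurable, but gives no
    joint measurability in the search and the hiding point. *)

(** * Points of a metric graph *)

Section ArcPoints.
Context {R : realType} (N : network R).
Implicit Types (e : net_arc N) (t : R).

Lemma arcptP e t (p : netpoint N) :
  (forall h : 0 < t < len e, Inner h = p) ->
  (~~ (0 < t < len e) -> Vertex (if t <= 0 then src e else tgt e) = p) ->
  arcpt e t = p.
Proof.
rewrite /arcpt => H1 H2.
(* The index of the boolean view is generalized on its own: it also occurs in
   the type of the proof that Inner carries. *)
suff H b (d : alt_spec (0 < t < len e) (0 < t < len e) b) :
    match d with
    | AltTrue h => Inner h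
    | AltFalse _ => Vertex (if t <= 0 then src e else tgt e)
    end = p by exact: H.
by case: d => h; [exact: H1 | exact: H2].
Qed.

Lemma arcpt_le0 e t : t <= 0 -> arcpt e t = Vertex (src e).
Proof.
move=> t0; apply: arcptP => [h|_]; last by rewrite t0.
by exfalso; case/andP: h; rewrite ltNge t0.
Qed.

Lemma arcpt_ge_len e t : len e <= t -> arcpt e t = Vertex (tgt e).
Proof.
move=> t1; apply: arcptP => [h|_].
  by exfalso; case/andP: h => _; rewrite ltNge t1.
by rewrite leNgt (lt_le_trans (len_gt0 e) t1).
Qed.

Lemma arcpt_inner e t (h : 0 < t < len e) : arcpt e t = Inner h.
Proof.
apply: arcptP => [h'|]; last by rewrite h.
by rewrite (bool_irrelevance h' h).
Qed.

Lemma net_openE (U : set (netpoint N)) :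
  open U = forall e, open (arcpt e @^-1` U).
Proof. by []. Qed.

Lemma arcpt_continuous e : continuous (arcpt e).
Proof. by apply/continuousP => A oA; exact: (oA e). Qed.

(** The topology is final for the arc parametrizations. *)
Lemma continuous_from_arcs (T : topologicalType) (f : netpoint N -> T) :
  (forall e, continuous (f \o arcpt e)) -> continuous f.
Proof.
move=> fc; apply/continuousP => A oA; rewrite net_openE => e.
by move/continuousP: (fc e) => /(_ A oA).
Qed.

Lemma arcpt_segment_connected e t : connected (arcpt e @` `[0, t]).
Proof.
apply: connected_continuous_connected; first exact: segment_connected.
exact/continuous_subspaceT/arcpt_continuous.
Qed.

End ArcPoints.

(** * Search times and mixtures of searches *)

Section RandomizedSearches.
Context {R : realType} (N : network R).
Implicit Types (S : expanding_search N) (H : netpoint N).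

Lemma search_time_ge0 S H : (0 <= search_time S H)%E.
Proof. by apply: le_ereal_inf_tmp => _ [t [t0 _ _] <-]; rewrite lee_fin. Qed.

Lemma search_time_le S H t : 0 <= t ->
  (t%:E <= length_measure [set: netpoint N])%E -> S t H ->
  (search_time S H <= t%:E)%E.
Proof. by move=> t0 t1 St; apply: ereal_inf_lbound; exists t. Qed.

Lemma search_time_anti S S' H :
  (forall t, 0 <= t -> (t%:E <= length_measure [set: netpoint N])%E ->
     S t H -> S' t H) -> (search_time S' H <= search_time S H)%E.
Proof.
move=> SS'; apply: ereal_inf_le_tmp => _ [t [t0 t1 St] <-].
by exists t => //; split=> //; exact: SS'.
Qed.

Section Measurability.
Variable S0 : expanding_search N.

(** The half-lines to the right generate the Borel sets of the extended reals,
    and their preimages are complements of search events. *)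
Lemma search_time_measurable H :
  measurable_fun [set: search_space S0]
    ((fun S => search_time S H) : search_space S0 -> \bar R).
Proof.
apply: (measurability _ (ErealGenOInfty.measurableE R)).
move=> /= _ [_ [a ->]] <-; rewrite setTI.
rewrite (_ : _ @^-1` _ = ~` [set S : searches S0 | (search_time S H <= a%:E)%E]).
  by apply: measurableC; apply: sub_sigma_algebra; exists H, a.
by apply/seteqP; split=> S /=; rewrite in_itv/= andbT ltNge => /negP.
Qed.

Lemma normalized_time_measurable H :
  measurable_fun [set: search_space S0]
    ((fun S => normalized_time S H) : search_space S0 -> \bar R).
Proof.
rewrite /normalized_time; case: (H == origin N); first exact: measurable_cst.
apply: emeasurable_funM; first exact: search_time_measurable.
exact: measurable_cst.
Qed.

(** It is enough to test measurability on the generating events. *)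
Lemma to_searches_measurable d (T : measurableType d)
    (F : T -> search_space S0) :
  (forall H t, measurable [set x | (search_time (F x) H <= t%:E)%E]) ->
  measurable_fun [set: T] F.
Proof.
move=> mF; apply: (@measurability _ _ T (search_space S0) setT F
  (@search_events R N S0)) => //.
by move=> _ [_ [H [t ->]] <-]; apply: measurableI => //; exact: mF.
Qed.

End Measurability.

Section Mixture.
Variables (A B C : expanding_search N) (D : R -> expanding_search N).
Let X := search_space A.
Hypothesis mD : measurable_fun [set: measurableTypeR R]
  (D : measurableTypeR R -> X).
Variables (P : probability (measurableTypeR R) R) (a b c d : {nonneg R}).
Hypothesis abcd : a%:num + b%:num + c%:num + d%:num = 1.

Let Dm : {mfun measurableTypeR R >-> X} :=
  HB.pack D (isMeasurableFun.Build _ _ _ _ (D : measurableTypeR R -> X) mD).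

(** The law of a search that is A, B or C with probability a, b or c and, with
    probability d, is D at a point drawn from P. *)
Definition mixture_law : set X -> \bar R :=
  measure_add (measure_add (measure_add (mscale a \d_(A : X))
    (mscale b \d_(B : X))) (mscale c \d_(C : X)))
    (mscale d (distribution P Dm)).

HB.instance Definition _ := Measure.on mixture_law.

Lemma mixture_lawE (E : set X) : mixture_law E =
  (a%:num%:E * \d_(A : X) E + b%:num%:E * \d_(B : X) E +
   c%:num%:E * \d_(C : X) E + d%:num%:E * P (D @^-1` E))%E.
Proof.
rewrite [LHS]measure_addE; congr (_ + _)%E.
by rewrite [LHS]measure_addE; congr (_ + _)%E; rewrite [LHS]measure_addE.
Qed.

Lemma mixture_law_setT : mixture_law setT = 1%E.
Proof.
rewrite mixture_lawE !diracT preimage_setT probability_setT !mule1 -!EFinD.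
by rewrite abcd.
Qed.

HB.instance Definition _ :=
  Measure_isProbability.Build _ _ _ mixture_law mixture_law_setT.

Definition mixture : randomized_search N := RandomizedSearch mixture_law.

Lemma integral_mixture (f : X -> \bar R) : measurable_fun setT f ->
  (forall S, 0 <= f S)%E ->
  (\int[mixture_law]_S f S =
   a%:num%:E * f A + b%:num%:E * f B + c%:num%:E * f C +
   d%:num%:E * \int[P]_u f (D u))%E.
Proof.
move=> mf f0; rewrite /mixture_law !ge0_integral_measure_add//.
rewrite !ge0_integral_mscale// !integral_dirac// !diracT !mul1e.
by rewrite ge0_integral_distribution.
Qed.

End Mixture.
End RandomizedSearches.

(** * Two integrals *)

Section Integrals.
Context {R : realType}.
Implicit Types (a b c y : R).

Lemma integral_affine a b c : 0 < c ->
  (\int[lebesgue_measure]_(u in `[0%R, c]) (a + b * u)%:E =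
   (a * c + b * (c ^+ 2 / 2))%:E)%E.
Proof.
move=> c0; pose F (u : R) := a * u + b * (u ^+ 2 / 2).
have dF (u : R) : is_derive u 1 F (a + b * u).
  rewrite /F; apply: is_derive_eq.
  by rewrite /GRing.scale/=; field.
rewrite (@continuous_FTC2 R (fun u => a + b * u) F 0 c c0).
- by rewrite /F -EFinB; congr _%:E; field.
- apply: continuous_subspaceT => u; apply: cvgD; first exact: cvg_cst.
  by apply: cvgM; [exact: cvg_cst|exact: cvg_id].
- have cF : continuous F.
    by move=> u; apply/differentiable_continuous/derivable1_diffP.
  split; first by move=> u _.
  + exact/cvg_at_right_filter/cF.
  + exact/cvg_at_left_filter/cF.
- by move=> u _; rewrite derive1E derive_val.
Qed.

Lemma integral_step a b c y : 0 <= a -> 0 <= b -> 0 <= y <= c ->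
  (\int[lebesgue_measure]_(u in `[0%R, c]) (a + b * \1_(`[0%R, y[%classic) u)%:E =
   (a * c + b * y)%:E)%E.
Proof.
move=> a0 b0 /andP[y0 yc].
under eq_integral do rewrite EFinD EFinM.
have mI : measurable_fun (`[0%R, c] : set (measurableTypeR R))
    (fun u => (\1_(`[0%R, y[%classic) u)%:E : \bar R).
  by apply/measurable_EFinP; apply: measurable_indic; exact: measurable_itv.
rewrite ge0_integralD//=; last 2 first.
- by move=> u _; rewrite -EFinM lee_fin mulr_ge0.
- exact: measurable_funeM.
rewrite ge0_integralZl//=.
rewrite integral_cst//= integral_indic//= setIidl; last first.
  move=> u /=; rewrite !in_itv/= => /andP[-> /ltW uy]/=.
  exact: le_trans yc.
rewrite !lebesgue_measure_itv/= !lte_fin.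
have c0 : 0 <= c by exact: le_trans yc.
by move: y0 c0; rewrite !le_eqVlt => /predU1P[<-|y0] /predU1P[<-|c0];
  rewrite ?ltxx ?y0 ?c0 ?oppr0 ?sube0 ?mulr0 ?mule0 ?adde0 ?addr0 ?add0e ?add0r.
Qed.

End Integrals.

(** * Finite sums *)

(** Expanding the left-hand weighted sum of ranks gives the sum of w i * w j over
    the pairs with T j <= T i. Each pair or its transpose satisfies this
    inequality, so the sum is at least half of the square of the total weight. *)
Lemma sum_rank_ge (R : realType) (I : finType) (w : I -> R) (T : I -> \bar R) :
  (forall i, 0 <= w i) ->
  (forall i, ((1 + \sum_(j | (T j <= T i)%E) w j)%:E <= T i)%E) ->
  ((\sum_i w i + (\sum_i w i) ^+ 2 / 2)%:E <= \sum_i (w i)%:E * T i)%E.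
Proof.
move=> w0 hT; set W := \sum_i w i.
pose X := \sum_i w i * (1 + \sum_(j | (T j <= T i)%E) w j).
apply: (@le_trans _ _ X%:E); last first.
  rewrite /X -sumEFin; apply: lee_sum => i _; rewrite EFinM.
  by apply: lee_wpmul2l; rewrite ?lee_fin.
rewrite lee_fin.
pose Z := \sum_i \sum_j w i * w j * (T j <= T i)%E%:R.
have XE : X = W + Z.
  rewrite /X /W /Z -big_split; apply: eq_bigr => i _ /=.
  rewrite mulrDr mulr1 mulr_sumr; congr (_ + _); rewrite big_mkcond.
  by apply: eq_bigr => j _; case: ifP; rewrite ?mulr1 ?mulr0.
have ZE : Z = \sum_i \sum_j w i * w j * (T i <= T j)%E%:R.
  rewrite /Z exchange_big; apply: eq_bigr => i _; apply: eq_bigr => j _ /=.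
  by rewrite (mulrC (w j)).
have : W ^+ 2 <= Z + Z.
  rewrite {2}ZE /Z -big_split/= expr2 {1}/W mulr_suml.
  apply: ler_sum => i _; rewrite -big_split/= /W mulr_sumr.
  apply: ler_sum => j _; rewrite -mulrDr ler_peMr ?mulr_ge0//.
  by have /orP[->|->] := le_total (T i) (T j); rewrite ?lerDl ?lerDr ler0n.
by rewrite XE; lra.
Qed.

(** Otherwise all elements would lie below the cardinal minus one, which leaves
    too little room for them. *)
Lemma exists_card_le_ord n (A : {set 'I_n}) : (0 < #|A|)%N ->
  exists2 k, k \in A & (#|A| <= k.+1)%N.
Proof.
move=> A0; apply/exists_inP; apply: contraT; rewrite negb_exists_in.
move=> /forall_inP h.
have hk k : k \in A -> (k < #|A|.-1)%N.
  by move=> /h; rewrite -ltnNge ltn_predRL.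
have cn : (#|A|.-1 <= n)%N.
  by rewrite (leq_trans (leq_pred _))// -[leqRHS](card_ord n) max_card.
suff : (#|A| <= #|A|.-1)%N by rewrite leqNgt ltn_predL A0.
rewrite -[leqRHS](card_ord #|A|.-1).
apply: leq_trans _ (leq_image_card (widen_ord cn) predT).
apply: subset_leq_card; apply/fintype.subsetP => k kA; apply/fintype.imageP.
by exists (Ordinal (hk k kA)) => //; exact: val_inj.
Qed.

Lemma sum_succ (R : realType) n :
  \sum_(k < n) (k.+1)%:R = n%:R * (n%:R + 1) / 2 :> R.
Proof.
elim: n => [|n IH]; first by rewrite big_ord0 mul0r mul0r.
by rewrite big_ord_recr/= IH -!natr1; field.
Qed.

(** * Geometry of the Y-network *)

Section YNetwork.
Context {R : realType} (L M : R) (L_gt0 : 0 < L) (LM : L <= M).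
Let Q := Ynet L_gt0 LM.
Let m := Mclip L M.
Implicit Types (e : Yarc) (t x y u : R) (p : netpoint Q).
Implicit Types (S : expanding_search Q).

Let M_gt0 : 0 < M. Proof. exact: lt_le_trans LM. Qed.
Let m_gt0 : 0 < m. Proof. exact: Mclip_gt0. Qed.
Let m_le_M : m <= M. Proof. by rewrite /m /Mclip ge_min lexx. Qed.

Definition pt e t : netpoint Q := @arcpt R Q e t.

(** Folding the other arm onto the centre maps the network onto the segment made
    of the stem followed by the arm a. This coordinate is continuous, and it
    separates the points of that segment. *)
Definition arm_pos (a e : Yarc) t : R :=
  match e with Stem => t | _ => if e == a then 1 + t else 1 end.

(** The same coordinate on points rather than on arc parameters. *)
Definition arm_coord (a : Yarc) p : R :=
  match p with
  | Vertex YRoot => 0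
  | Vertex YCenter => 1
  | Vertex YLeft => arm_pos a LeftArc L
  | Vertex YRight => arm_pos a RightArc M
  | Inner e t _ => arm_pos a e t
  end.

Lemma arm_coord_pt (a e : Yarc) t : a != Stem -> 0 <= t <= Ylen L M e ->
  arm_coord a (pt e t) = arm_pos a e t.
Proof.
move=> aS /andP[]; rewrite le_eqVlt => /predU1P[<-|t0] tl.
  rewrite /pt arcpt_le0//=.
  by case: e tl => //= _; rewrite addr0 if_same.
move: tl; rewrite le_eqVlt => /predU1P[->|tl].
  by rewrite /pt arcpt_ge_len//; case: e.
have h : 0 < t < @len R Q e by rewrite t0.
by rewrite /pt (arcpt_inner h).
Qed.

Lemma pt_clamp e t : pt e (Num.max 0 (Num.min t (Ylen L M e))) = pt e t.
Proof.
have l0 := Ylen_gt0 L_gt0 LM e.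
rewrite /pt; case: (leP t 0) => t0.
  by rewrite !arcpt_le0 ?ge_max ?lexx ?ge_min ?t0.
case: (leP (Ylen L M e) t) => t1.
  by rewrite !arcpt_ge_len ?le_max ?lexx ?orbT.
by rewrite max_r// ltW.
Qed.

Lemma arm_coord_continuous (a : Yarc) : a != Stem -> continuous (arm_coord a).
Proof.
move=> aS; apply: continuous_from_arcs => e.
have l0 := Ylen_gt0 L_gt0 LM e.
have -> : arm_coord a \o arcpt e =
          arm_pos a e \o (fun t => Num.max 0 (Num.min t (Ylen L M e))).
  apply/funext => t /=; rewrite -[arcpt e t]/(pt e t) -pt_clamp arm_coord_pt//.
  by rewrite le_max lexx/= ge_max ge_min lexx orbT ltW.
move=> t; apply: continuous_comp.
  apply: (@continuous_max R R (fun=> 0)); first exact: cvg_cst.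
  by apply: (@continuous_min R R id (fun=> _)); [exact: cvg_id|exact: cvg_cst].
case: (e); rewrite /arm_pos; first exact: cvg_id.
- by case: (_ == _); [apply: cvgD; [exact: cvg_cst|exact: cvg_id]|exact: cvg_cst].
- by case: (_ == _); [apply: cvgD; [exact: cvg_cst|exact: cvg_id]|exact: cvg_cst].
Qed.

Lemma pt_center (a : Yarc) : a != Stem -> pt a 0 = pt Stem 1.
Proof. by move=> aS; rewrite /pt arcpt_le0// arcpt_ge_len//; case: a aS. Qed.

Lemma pt_cases p :
  [\/ exists2 t, 0 <= t <= 1 & p = pt Stem t
    , exists2 t, 0 < t <= L & p = pt LeftArc t
    | exists2 t, 0 < t <= M & p = pt RightArc t].
Proof.
case: p => [[]|[] t h].
- by apply: Or31; exists 0; rewrite ?lexx ?ler01//; rewrite /pt arcpt_le0.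
- by apply: Or31; exists 1; rewrite ?lexx ?ler01//; rewrite /pt arcpt_ge_len.
- by apply: Or32; exists L; rewrite ?lexx ?L_gt0//; rewrite /pt arcpt_ge_len.
- by apply: Or33; exists M; rewrite ?lexx ?M_gt0//; rewrite /pt arcpt_ge_len.
- apply: Or31; exists t; rewrite /pt ?(arcpt_inner h)//.
  by case/andP: h => /ltW -> /ltW.
- apply: Or32; exists t; rewrite /pt ?(arcpt_inner h)//.
  by case/andP: h => -> /ltW.
- apply: Or33; exists t; rewrite /pt ?(arcpt_inner h)//.
  by case/andP: h => -> /ltW.
Qed.

(** The depth of a vertex, used as a potential: it varies by at most the length
    of an arc along that arc, which bounds below the length of every walk. *)
Definition vertex_pot (v : Yvertex) : R :=
  match v with YRoot => 0 | YCenter => 1 | YLeft => 1 + L | YRight => 1 + M end.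

Lemma walk_length_ge (x y : vertex Q) (w : seq (net_arc Q * bool)) :
  net_walk x w y -> vertex_pot y - vertex_pot x <= \sum_(a <- w) len a.1.
Proof.
elim: w x => [|[e b] w IH] x /=; first by move=> /eqP ->; rewrite big_nil subrr.
move=> /andP[/eqP <- /IH]; rewrite big_cons/=.
set s := \sum_(_ <- _) _ => h.
suff : vertex_pot (if b then Ytgt e else Ysrc e) -
       vertex_pot (if b then Ysrc e else Ytgt e) <= Ylen L M e.
  by move=> h2; have := lerD h2 h; rewrite addrC subrKA.
have L0 := L_gt0; have M0 := M_gt0.
by clear h; case: e b => [] [] /=; lra.
Qed.

Lemma vertex_dist_root (v : vertex Q) : vertex_dist (net_root Q) v = vertex_pot v.
Proof.
have [w ww wl] : exists2 w : seq (net_arc Q * bool),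
    net_walk (net_root Q) w v & \sum_(a <- w) len a.1 = vertex_pot v.
  case: v.
  - by exists [::]; rewrite ?big_nil.
  - by exists [:: (Stem : net_arc Q, true)]; rewrite ?big_seq1.
  - exists [:: (Stem : net_arc Q, true); (LeftArc : net_arc Q, true)] => //.
    by rewrite big_cons big_seq1.
  - exists [:: (Stem : net_arc Q, true); (RightArc : net_arc Q, true)] => //.
    by rewrite big_cons big_seq1.
apply/eqP; rewrite eq_le; apply/andP; split.
- rewrite -wl; apply: ge_inf; last by exists w.
  exists 0 => _ [p _ <-]; apply: sumr_ge0 => a _; exact/ltW/len_gt0.
- apply: lb_le_inf; first by exists (\sum_(a <- w) len a.1), w.
  by move=> _ [p /walk_length_ge + <-]; rewrite /= subr0.
Qed.

Definition depth e t : R := match e with Stem => t | _ => 1 + t end.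

Lemma root_dist_pt e t : 0 <= t <= Ylen L M e -> root_dist (pt e t) = depth e t.
Proof.
move=> /andP[]; rewrite le_eqVlt => /predU1P[<-|t0] tl.
  rewrite /pt arcpt_le0//= vertex_dist_root; case: e tl => //= _; exact/esym/addr0.
move: tl; rewrite le_eqVlt => /predU1P[->|tl].
  by rewrite /pt arcpt_ge_len//= vertex_dist_root; case: e.
have h : 0 < t < @len R Q e by rewrite t0.
rewrite /pt (arcpt_inner h) /root_dist !vertex_dist_root.
by rewrite min_l; case: (e) tl => /=; lra.
Qed.

Lemma pt_origin e t : 0 <= t <= Ylen L M e -> pt e t = origin Q -> depth e t = 0.
Proof.
by move=> /root_dist_pt <- ->; exact: (vertex_dist_root YRoot).
Qed.

(** * Expanding searches that follow a profile *)

Lemma mem_segment e a y : 0 <= y <= Ylen L M e -> a <= Ylen L M e ->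
  (pt e @` `[0, a]) (pt e y) <-> y <= a.
Proof.
move=> yl al; split=> [[z /=]|ya]; last first.
  by exists y => //=; rewrite in_itv/= ya andbT; case/andP: yl.
rewrite in_itv/= => /andP[z0 za] zy.
pose b := if e is Stem then LeftArc else e.
have bS : b != Stem by rewrite /b; case: (e).
have := congr1 (arm_coord b) zy.
rewrite !arm_coord_pt ?z0 ?(le_trans za)//.
by rewrite /b; move: za; case: (e) => /=; rewrite ?eqxx; lra.
Qed.

(** Distinct arcs meet only in the centre, and the stem reaches it at
    parameter 1. *)
Lemma mem_other_segment e e' a y : e != Stem -> e' != e ->
  0 <= y <= Ylen L M e -> a <= Ylen L M e' ->
  (pt e' @` `[0, a]) (pt e y) -> y = 0 /\ (e' = Stem -> 1 <= a).
Proof.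
move=> eS ee yl al [z /=]; rewrite in_itv/= => /andP[z0 za].
move=> /(congr1 (arm_coord e)); rewrite !arm_coord_pt ?z0 ?(le_trans za)//.
have -> : arm_pos e e y = 1 + y by case: (e) eS => //= _; rewrite eqxx.
case/andP: yl => y0 _.
have [e'S|e'S] := eqVneq e' Stem.
  rewrite e'S /= in al *; by move=> zy; split=> [|_]; lra.
have -> : arm_pos e e' z = 1.
  by case: (e') e'S ee => //= _ /negbTE ee; rewrite ee.
by move=> zy; split=> [|/eqP]; [lra|rewrite (negbTE e'S)].
Qed.

Lemma length_measureE (A : set (netpoint Q)) :
  length_measure A =
  (lebesgue_measure (`[0%R, 1%R]%classic `&` pt Stem @^-1` A) +
   lebesgue_measure (`[0%R, L]%classic `&` pt LeftArc @^-1` A) +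
   lebesgue_measure (`[0%R, M]%classic `&` pt RightArc @^-1` A))%E.
Proof.
rewrite /length_measure (bigD1 Stem)//= (bigD1 LeftArc)//= (bigD1 RightArc)//=.
by rewrite big1 ?adde0 ?addeA//; case.
Qed.

Lemma lebesgue_segment (a : R) : 0 <= a -> lebesgue_measure `[0, a]%classic = a%:E.
Proof.
move=> a0; rewrite lebesgue_measure_itv/= lte_fin.
by case: ltgtP a0 => // [_|<-]; rewrite ?sube0.
Qed.

Lemma length_net : length_measure [set: netpoint Q] = (1 + L + M)%:E.
Proof.
rewrite length_measureE !preimage_setT !setIT !lebesgue_segment//.
all: exact/ltW.
Qed.

(** The shape of every set reached once the stem has been searched. *)
Definition arms (a b : R) : set (netpoint Q) :=
  pt Stem @` `[0, 1] `|` pt LeftArc @` `[0, a] `|` pt RightArc @` `[0, b].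

Definition arm_length (a b : R) e : R :=
  match e with Stem => 1 | LeftArc => a | RightArc => b end.

Lemma mem_arms a b e y : 0 <= a <= L -> 0 <= b <= M -> 0 <= y <= Ylen L M e ->
  arms a b (pt e y) <-> y <= arm_length a b e.
Proof.
move=> /andP[a0 aL] /andP[b0 bM] yl; split; last first.
  case: e yl => /= yl ya.
  - by do 2 left; apply/mem_segment.
  - by left; right; apply/mem_segment.
  - by right; apply/mem_segment.
case: e yl => /= yl; first by case/andP: yl.
- move=> [[]|]; [|by move/mem_segment; exact|];
    by move=> /mem_other_segment[]//= ->.
- move=> [[]|]; [| |by move/mem_segment; exact];
    by move=> /mem_other_segment[]//= ->.
Qed.

Lemma length_arms a b : 0 <= a <= L -> 0 <= b <= M ->
  length_measure (arms a b) = (1 + a + b)%:E.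
Proof.
move=> aL bM; rewrite length_measureE.
have H e : `[0, Ylen L M e]%classic `&` pt e @^-1` arms a b =
           `[0, arm_length a b e]%classic.
  have al : arm_length a b e <= Ylen L M e.
    by case: (e) => //=; [case/andP: aL|case/andP: bM].
  apply/seteqP; split => y /=; rewrite !in_itv/=.
    move=> [yl /mem_arms]; rewrite aL bM yl => /(_ isT isT isT) ->.
    by case/andP: yl => ->.
  move=> /andP[y0 ya]; have yl : 0 <= y <= Ylen L M e by rewrite y0 (le_trans ya).
  by split=> //; apply/mem_arms.
rewrite (H Stem) (H LeftArc) (H RightArc) !lebesgue_segment//.
- by case/andP: bM.
- by case/andP: aL.
Qed.

Lemma length_stem t : 0 <= t < 1 -> length_measure (pt Stem @` `[0, t]) = t%:E.
Proof.
move=> /andP[t0 t1]; rewrite length_measureE.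
have H e : e != Stem ->
    `[0, Ylen L M e]%classic `&` pt e @^-1` (pt Stem @` `[0, t]) = set0.
  move=> eS; rewrite -subset0 => y [/=]; rewrite in_itv/= => yl.
  move=> /mem_other_segment[]//; first by rewrite eq_sym.
    exact/ltW.
  by move=> _ /(_ erefl); rewrite leNgt t1.
rewrite (H LeftArc)// (H RightArc)// !measure0 !adde0.
have -> : `[0, 1]%classic `&` pt Stem @^-1` (pt Stem @` `[0, t]) = `[0, t]%classic.
  apply/seteqP; split => y /=; rewrite !in_itv/=.
    move=> [yl /mem_segment]; rewrite /= yl (ltW t1) => /(_ isT isT) ->.
    by case/andP: yl => ->.
  move=> /andP[y0 yt]; have yl : 0 <= y <= 1 by rewrite y0 (le_trans yt)// ltW.
  by split=> //; apply/mem_segment => //=; exact: ltW.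
by rewrite lebesgue_segment.
Qed.

(** The functions left for which (left tau, tau - left tau) is the pair of
    lengths searched in the arms at time tau after the stem: both components
    are nondecreasing, and they end at L and M. *)
Definition profile (left : R -> R) : Prop :=
  [/\ left 0 = 0, left (L + M) = L &
      forall x y, 0 <= x -> x <= y -> y <= L + M ->
        left x <= left y /\ left y - left x <= y - x].

Lemma profile_left left t : profile left -> 0 <= t <= L + M -> 0 <= left t <= L.
Proof.
move=> [l0 l1 lm] /andP[t0 t1].
have [] := lm _ _ (lexx 0) t0 t1; have [] := lm _ _ t0 t1 (lexx _).
by rewrite l0 l1 => -> _ ->.
Qed.

Lemma profile_right left t : profile left -> 0 <= t <= L + M ->
  0 <= t - left t <= M.
Proof.
move=> [l0 l1 lm] /andP[t0 t1].
have [] := lm _ _ (lexx 0) t0 t1; have [] := lm _ _ t0 t1 (lexx _).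
by rewrite l0 l1; lra.
Qed.

Definition path_set (left : R -> R) t : set (netpoint Q) :=
  if t < 1 then pt Stem @` `[0, t]
  else arms (left (t - 1)) (t - 1 - left (t - 1)).

Lemma arms00 : arms 0 0 = pt Stem @` `[0, 1].
Proof.
apply/seteqP; split; last by move=> p ?; do 2 left.
move=> p [[//|]|] [z] /=; rewrite in_itv/= -eq_le => /eqP <- <-.
all: by rewrite pt_center//; exists 1; rewrite //= in_itv/= ler01 lexx.
Qed.

Lemma arms_connected a b : 0 <= a -> 0 <= b -> connected (arms a b).
Proof.
move=> a0 b0.
have stem1 : (pt Stem @` `[0, 1]) (pt Stem 1).
  by exists 1; rewrite //= in_itv/= ler01 lexx.
apply: connectedU.
- exists (pt Stem 1); split; first by left.
  by exists 0; rewrite ?pt_center//= in_itv/= lexx.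
- apply: connectedU; [|exact: arcpt_segment_connected..].
  exists (pt Stem 1); split=> //.
  by exists 0; rewrite ?pt_center//= in_itv/= lexx.
- exact: arcpt_segment_connected.
Qed.

Section PathSearch.
Variables (left : R -> R) (lP : profile left).

Lemma path_set0 : path_set left 0 = [set origin Q].
Proof.
rewrite /path_set ltr01; apply/seteqP; split => p.
  move=> [z] /=; rewrite in_itv/= -eq_le => /eqP <- <-.
  by rewrite /pt arcpt_le0.
move=> ->; exists 0; rewrite /= ?in_itv/= ?lexx//.
by rewrite /pt arcpt_le0.
Qed.

Let time_range t : (t%:E <= length_measure [set: netpoint Q])%E -> 1 <= t ->
  0 <= t - 1 <= L + M.
Proof. by rewrite length_net lee_fin; lra. Qed.

Lemma path_set_connected t : 0 <= t ->
  (t%:E <= length_measure [set: netpoint Q])%E -> connected (path_set left t).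
Proof.
move=> t0 /time_range tr; rewrite /path_set; case: ltP => t1.
  exact: arcpt_segment_connected.
have /andP[? ?] := profile_left lP (tr t1).
have /andP[? ?] := profile_right lP (tr t1).
exact: arms_connected.
Qed.

Lemma path_set_mono t t' : 0 <= t -> t <= t' ->
  (t'%:E <= length_measure [set: netpoint Q])%E ->
  path_set left t `<=` path_set left t'.
Proof.
move=> t0 tt' /time_range tr; rewrite /path_set.
case: (ltP t' 1) => t'1.
  rewrite (le_lt_trans tt')//; apply: image_subset => y /=.
  by rewrite !in_itv/= => /andP[-> /le_trans]; exact.
case: ltP => t1.
  move=> p [y]; rewrite /= in_itv/= => /andP[y0 yt] <-; do 2 left.
  by exists y => //=; rewrite in_itv/= y0 (le_trans yt)// ltW.
have [_ _ lm] := lP.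
have [|||l1 l2] := lm (t - 1) (t' - 1).
- by move: t1; lra.
- by move: tt'; lra.
- by case/andP: (tr t'1).
have sub e a b : a <= b -> pt e @` `[0, a] `<=` pt e @` `[0, b].
  move=> ab; apply: image_subset => y /=.
  by rewrite !in_itv/= => /andP[-> /le_trans]; exact.
apply: setUSS; last by apply: sub; move: l2; lra.
exact/setUS/sub.
Qed.

Lemma path_set_length t : 0 <= t ->
  (t%:E <= length_measure [set: netpoint Q])%E ->
  length_measure (path_set left t) = t%:E.
Proof.
move=> t0 /time_range tr; rewrite /path_set; case: ltP => t1.
  by rewrite length_stem// t0.
rewrite length_arms; [|exact: profile_left (tr t1)|exact: profile_right (tr t1)].
by congr _%:E; lra.
Qed.

Definition path_search : expanding_search Q :=
  ExpandingSearch path_set0 path_set_connected path_set_mono path_set_length.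

Lemma path_search_follows : follows path_search left.
Proof.
have [l0 _ _] := lP; split=> t /andP[t0 t1]; rewrite /= /path_set.
  case: ltP => // t1'.
  have -> : t = 1 by apply/le_anti; rewrite t1.
  by rewrite subrr l0 subr0 arms00.
by rewrite ltNge lerDl t0/= addrAC subrr add0r.
Qed.

End PathSearch.
(** * The four strategies *)

Lemma Mclip_ge : L <= m.
Proof.
have L0 := L_gt0.
rewrite /m /Mclip le_min LM -[leLHS]gtr0_norm// -sqrtr_sqr ler_sqrt; nra.
Qed.

Lemma Mclip_sqr_le : m ^+ 2 <= L * (L + 2).
Proof.
have L0 := L_gt0.
rewrite -[leRHS]sqr_sqrtr; last by nra.
by rewrite ler_sqr ?nnegrE ?sqrtr_ge0 ?(ltW m_gt0)// /m /Mclip ge_min lexx orbT.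
Qed.

Lemma Mclip_sqr : m < M -> m ^+ 2 = L * (L + 2).
Proof.
have L0 := L_gt0.
rewrite /m /Mclip gt_min ltxx/= => /ltW h.
by rewrite min_r// sqr_sqrtr//; nra.
Qed.

Lemma left_then_right_profile : profile (left_then_right L).
Proof.
have L0 := L_gt0; have M0 := M_gt0; rewrite /left_then_right; split.
- by rewrite min_l// ltW.
- by rewrite min_r// lerDl ltW.
- by move=> x y x0 xy _; case: (leP x L); case: (leP y L); lra.
Qed.

Lemma right_left_right_profile u : 0 <= u <= M ->
  profile (right_left_right L u).
Proof.
have L0 := L_gt0; have M0 := M_gt0.
move=> /andP[u0 uM]; rewrite /right_left_right; split.
- by rewrite sub0r max_r ?oppr_le0// min_l// ltW.
- by rewrite max_l ?min_r//; lra.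
- move=> x y x0 xy _.
  have : Num.max (x - u) 0 <= Num.max (y - u) 0 /\
      Num.max (y - u) 0 - Num.max (x - u) 0 <= y - x.
    by case: (leP (x - u) 0); case: (leP (y - u) 0); lra.
  move: (Num.max (x - u) 0) (Num.max (y - u) 0) => a b.
  by case: (leP a L); case: (leP b L); lra.
Qed.

Lemma simultaneous_profile : profile (simultaneous L m).
Proof.
have L0 := L_gt0; have m0 := m_gt0; rewrite /simultaneous; split.
- by rewrite min_l ?mul0r// addr_ge0// ltW.
- by rewrite min_r ?lerD2l// mulrCA divff ?mulr1// gt_eqF// addr_gt0.
- move=> x y x0 xy _; set r := L / (L + m).
  have r0 : 0 <= r by rewrite divr_ge0 ?addr_ge0// ltW.
  have r1 : r <= 1 by rewrite ler_pdivrMr ?addr_gt0// mul1r lerDl ltW.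
  have : Num.min x (L + m) <= Num.min y (L + m) /\
      Num.min y (L + m) - Num.min x (L + m) <= y - x.
    by case: (leP x (L + m)); case: (leP y (L + m)); lra.
  move: (Num.min x _) (Num.min y _) => a b [ab ba].
  rewrite -mulrBl ler_wpM2r//; split=> //.
  by apply: le_trans ba; rewrite ler_piMr// subr_ge0.
Qed.

(** Whether a point of an arm has been reached at a given time depends only on
    the length searched in that arm, so search times can be compared through
    profiles. *)
Lemma path_search_time_anti left left' (lP : profile left)
    (lP' : profile left') e y : 0 <= y <= Ylen L M e ->
  (forall tau, 0 <= tau <= L + M ->
     y <= arm_length (left tau) (tau - left tau) e ->
     y <= arm_length (left' tau) (tau - left' tau) e) ->
  (search_time (path_search lP') (pt e y) <=
   search_time (path_search lP) (pt e y))%E.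
Proof.
move=> yl h; apply: search_time_anti => t t0.
rewrite length_net lee_fin => tm; rewrite /= /path_set; case: ltP => // t1.
have tr : 0 <= t - 1 <= L + M by move: t1 tm; lra.
move/(mem_arms (profile_left lP tr) (profile_right lP tr) yl).
move/(h _ tr) => ?.
by apply/(mem_arms (profile_left lP' tr) (profile_right lP' tr) yl).
Qed.

Lemma path_search_time_arm left (lP : profile left) e y tau :
  0 <= y <= Ylen L M e -> 0 <= tau <= L + M ->
  y <= arm_length (left tau) (tau - left tau) e ->
  (search_time (path_search lP) (pt e y) <= (1 + tau)%:E)%E.
Proof.
move=> yl taur h; have /andP[t0 t1] := taur.
apply: search_time_le; first by lra.
  by rewrite length_net lee_fin; lra.
rewrite /= /path_set ltNge lerDl t0/= addrAC subrr add0r.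
by apply/(mem_arms (profile_left lP taur) (profile_right lP taur) yl).
Qed.

Lemma path_search_time_stem left (lP : profile left) t : 0 <= t <= 1 ->
  (search_time (path_search lP) (pt Stem t) <= t%:E)%E.
Proof.
have L0 := L_gt0; have M0 := M_gt0.
move=> /andP[t0 t1]; apply: search_time_le => //.
  by rewrite length_net lee_fin; lra.
rewrite /= /path_set; case: ltP => t1'.
  by exists t => //=; rewrite in_itv/= t0 lexx.
by do 2 left; exists t => //=; rewrite in_itv/= t0.
Qed.

Definition searchA : expanding_search Q :=
  path_search left_then_right_profile.

Lemma m_range : 0 <= m <= M.
Proof. by rewrite m_le_M ltW. Qed.

Definition searchB : expanding_search Q :=
  path_search (right_left_right_profile m_range).

Definition searchC : expanding_search Q :=
  path_search simultaneous_profile.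

(** Strategy (D) draws u in [0, m], but its family of searches is indexed by all
    reals. *)
Definition clamp u : R := Num.max 0 (Num.min u m).

Lemma clamp_range u : 0 <= clamp u <= M.
Proof.
rewrite /clamp le_max lexx/= ge_max (ltW M_gt0)/=.
by rewrite (le_trans _ m_le_M)// ge_min lexx orbT.
Qed.

Lemma clamp_id u : 0 <= u <= m -> clamp u = u.
Proof. by move=> /andP[u0 um]; rewrite /clamp min_l// max_r. Qed.

Lemma clamp_homo : {homo clamp : u v / u <= v}.
Proof.
move=> u v uv; rewrite /clamp.
have : Num.min u m <= Num.min v m by case: (leP u m); case: (leP v m); lra.
by move: (Num.min u m) (Num.min v m) => a b; case: (leP 0 a); case: (leP 0 b); lra.
Qed.

Definition searchD u : expanding_search Q :=
  path_search (right_left_right_profile (clamp_range u)).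

Lemma searchD_follows u : 0 <= u <= m ->
  follows (searchD u) (right_left_right L u).
Proof. by move=> /clamp_id {2}<-; exact: path_search_follows. Qed.

Lemma right_left_right_anti u v tau : u <= v ->
  right_left_right L v tau <= right_left_right L u tau.
Proof.
move=> uv; rewrite /right_left_right le_min !ge_min lexx orbT andbT.
by rewrite ge_max !le_max lexx !orbT lerB.
Qed.

(** A longer first excursion on the right delays the left arm and advances the
    right arm. Each search time is therefore monotone in u, and its sublevel
    sets are intervals. *)
Lemma searchD_measurable :
  measurable_fun [set: measurableTypeR R]
    (searchD : measurableTypeR R -> search_space searchA).
Proof.
apply: to_searches_measurable => H t; apply: is_interval_measurable.
have mono_left u v y : u <= v -> 0 <= y <= L ->
    (search_time (searchD u) (pt LeftArc y) <=
     search_time (searchD v) (pt LeftArc y))%E.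
  move=> uv yl; apply: path_search_time_anti => //= tau _ /le_trans; apply.
  exact/right_left_right_anti/clamp_homo.
have mono_right u v y : u <= v -> 0 <= y <= M ->
    (search_time (searchD v) (pt RightArc y) <=
     search_time (searchD u) (pt RightArc y))%E.
  move=> uv yl; apply: path_search_time_anti => //= tau _ /le_trans; apply.
  by rewrite lerD2l lerN2; exact/right_left_right_anti/clamp_homo.
have cst_stem u v y : 0 <= y <= 1 ->
    (search_time (searchD v) (pt Stem y) <=
     search_time (searchD u) (pt Stem y))%E.
  by move=> yl; exact: path_search_time_anti.
move=> u v /= Hu Hv w /andP[uw wv].
case: (pt_cases H) Hu Hv => -[y yl ->] Hu Hv.
- by apply: le_trans Hu; exact: cst_stem.
- apply: le_trans Hv; apply: mono_left => //.
  by case/andP: yl => /ltW -> ->.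
- apply: le_trans Hu; apply: mono_right => //.
  by case/andP: yl => /ltW -> ->.
Qed.

(** * The mixed strategy has ratio at most V *)

Definition denom : R := L * (L + 2) + m * (m + 2).

Let V := 1 + 2 * L * m / denom.

Lemma denom_gt0 : 0 < denom.
Proof. by rewrite /denom addr_gt0// mulr_gt0// addr_gt0. Qed.

Lemma probA_ge0 : 0 <= 2 * m / denom.
Proof. by rewrite divr_ge0 ?mulr_ge0// ltW// denom_gt0. Qed.

Lemma probB_ge0 : 0 <= (L ^+ 2 + 2 * L - m ^+ 2) / denom.
Proof.
rewrite divr_ge0 ?(ltW denom_gt0)// subr_ge0 (le_trans Mclip_sqr_le)//.
by rewrite mulrDr expr2 (mulrC L 2).
Qed.

Lemma probC_ge0 : 0 <= 2 * L ^+ 2 / denom.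
Proof. by rewrite divr_ge0 ?(ltW denom_gt0)// mulr_ge0// sqr_ge0. Qed.

Lemma probD_ge0 : 0 <= (2 * m ^+ 2 - 2 * L ^+ 2) / denom.
Proof.
rewrite divr_ge0 ?(ltW denom_gt0)// subr_ge0 ler_pM2l//.
by rewrite ler_sqr ?nnegrE ?(ltW L_gt0) ?(ltW m_gt0) ?Mclip_ge.
Qed.

Lemma prob_sum : (NngNum probA_ge0)%:num + (NngNum probB_ge0)%:num +
  (NngNum probC_ge0)%:num + (NngNum probD_ge0)%:num = 1.
Proof.
rewrite /= -!mulrDl; apply: (mulIf (lt0r_neq0 denom_gt0)).
by rewrite divfK ?lt0r_neq0 ?denom_gt0// mul1r /denom; ring.
Qed.

Definition strategy : randomized_search Q :=
  mixture (searchB) (searchC)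
    searchD_measurable (uniform_prob (Mclip_gt0 L_gt0 LM)) prob_sum.

(** Upper bounds on the search times under the four strategies suffice, since
    all probabilities are nonnegative. The last hypothesis is the bound by V on
    the expected time divided by the depth, with denominators cleared. *)
Lemma expected_time_le e t (tA tB tC G : R) (g : R -> R) :
  0 <= t <= Ylen L M e -> 0 < depth e t ->
  (search_time (searchA) (pt e t) <= tA%:E)%E ->
  (search_time (searchB) (pt e t) <= tB%:E)%E ->
  (search_time (searchC) (pt e t) <= tC%:E)%E ->
  (forall u, 0 <= u <= m ->
     (search_time (searchD u) (pt e t) <= (g u)%:E)%E) ->
  measurable_fun setT g ->
  (\int[lebesgue_measure]_(u in `[0%R, m]) (g u)%:E = G%:E)%E ->
  2 * m * tA + (L ^+ 2 + 2 * L - m ^+ 2) * tB + 2 * L ^+ 2 * tC +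
    (2 * m ^+ 2 - 2 * L ^+ 2) * (G / m) <= (denom + 2 * L * m) * depth e t ->
  (expected_normalized_time strategy (pt e t) <= V%:E)%E.
Proof.
move=> tl d0 hA hB hC hD mg hG hV.
have nO : (pt e t == origin Q) = false.
  by apply/eqP => /(pt_origin tl) d00; move: d0; rewrite d00 ltxx.
rewrite /expected_normalized_time /normalized_time nO (root_dist_pt tl).
rewrite ge0_integralZr//; last 3 first.
- exact: search_time_measurable.
- by move=> S _; exact: search_time_ge0.
- by rewrite lee_fin invr_ge0 ltW.
rewrite integral_mixture; [|exact: search_time_measurable|]; last first.
  by move=> S; exact: search_time_ge0.
have mT : measurable_fun [set: measurableTypeR R]
    (fun u => search_time (searchD u) (pt e t) : \bar R).
  exact: (measurableT_comp (search_time_measurable (S0 := searchA) (pt e t))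
    searchD_measurable).
rewrite integral_uniform//; last by move=> u; exact: search_time_ge0.
have hI : (\int[lebesgue_measure]_(u in `[0%R, m])
    search_time (searchD u) (pt e t) <= G%:E)%E.
  rewrite -hG; apply: ge0_le_integral => //.
  - by move=> u _; exact: search_time_ge0.
  - exact: measurable_funS mT.
  - by apply/measurable_EFinP; exact: measurable_funS mg.
rewrite lee_pdivrMr// -EFinM.
apply: (@le_trans _ _ ((2 * m / denom)%:E * tA%:E +
   ((L ^+ 2 + 2 * L - m ^+ 2) / denom)%:E * tB%:E +
   (2 * L ^+ 2 / denom)%:E * tC%:E +
   ((2 * m ^+ 2 - 2 * L ^+ 2) / denom)%:E * ((m - 0)^-1%:E * G%:E))%E).
  apply: leeD; [apply: leeD; [apply: leeD|]|].
  - by apply: lee_wpmul2l; rewrite ?lee_fin ?probA_ge0.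
  - by apply: lee_wpmul2l; rewrite ?lee_fin ?probB_ge0.
  - by apply: lee_wpmul2l; rewrite ?lee_fin ?probC_ge0.
  - apply: lee_wpmul2l; first by rewrite lee_fin probD_ge0.
    by apply: lee_wpmul2l => //; rewrite lee_fin invr_ge0 subr0 ltW.
rewrite -!EFinM -!EFinD lee_fin -(ler_pM2r denom_gt0).
have D0 := lt0r_neq0 denom_gt0; have m0 := lt0r_neq0 m_gt0.
rewrite [leRHS](_ : _ = (denom + 2 * L * m) * depth e t); last first.
  by rewrite /V; field.
apply: le_trans hV; rewrite le_eqVlt; apply/orP; left; apply/eqP.
by rewrite subr0; field; rewrite m0 D0.
Qed.

Lemma V_ge1 : 1 <= V.
Proof.
rewrite /V lerDl divr_ge0 ?(ltW denom_gt0)// !mulr_ge0//; exact/ltW.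
Qed.

Lemma expected_time_stem t : 0 < t <= 1 ->
  (expected_normalized_time strategy (pt Stem t) <= V%:E)%E.
Proof.
move=> /andP[t0 t1]; have t01 : 0 <= t <= 1 by rewrite ltW.
have L0 := L_gt0; have m0 := m_gt0.
apply: (@expected_time_le Stem t t t t (t * m) (fun=> t)) => //.
1-3: exact: path_search_time_stem.
- by move=> u _; exact: path_search_time_stem.
- by rewrite (integral_cst _ _ t%:E)//=
       lebesgue_measure_itv/= lte_fin m_gt0 oppr0 adde0.
- rewrite mulfK ?gt_eqF// [leLHS](_ : _ = denom * t).
    by rewrite ler_wpM2r ?(ltW t0)// lerDl !mulr_ge0// ltW.
  by rewrite /denom; ring.
Qed.

(** The delay behind the depth 1 + x is 0 under (A), m under (B), x m / L under
    (C) and u under (D). *)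
Lemma expected_time_left x : 0 < x <= L ->
  (expected_normalized_time strategy (pt LeftArc x) <= V%:E)%E.
Proof.
move=> /andP[x0 xL]; have xl : 0 <= x <= L by rewrite ltW.
have L0 := L_gt0; have m0 := m_gt0; have mM := m_le_M.
have Lm0 : 0 < L + m by lra.
apply: (@expected_time_le LeftArc x (1 + x) (1 + (m + x))
  (1 + x * (L + m) / L) ((1 + x) * m + 1 * (m ^+ 2 / 2))
  (fun u => (1 + x) + 1 * u)) => //=.
- by lra.
- apply: path_search_time_arm => //=; first by lra.
  by rewrite /left_then_right min_l.
- apply: path_search_time_arm => //=; first by lra.
  by rewrite /right_left_right addrAC subrr add0r max_l ?min_l// ltW.
- have xLm : x * (L + m) / L <= L + m.
    by rewrite ler_pdivrMr// mulrC ler_wpM2l// ltW.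
  apply: path_search_time_arm => //=.
    rewrite divr_ge0 ?mulr_ge0 ?(ltW x0) ?(ltW Lm0) ?(ltW L0)//=.
    by apply: le_trans xLm _; lra.
  rewrite /simultaneous -/m min_l// le_eqVlt; apply/orP; left; apply/eqP.
  by field; rewrite !gt_eqF.
- move=> u um; have /andP[u0 u1] := um.
  rewrite mul1r -addrA.
  apply: path_search_time_arm => //=; first by lra.
  by rewrite clamp_id// /right_left_right addrK max_l ?min_l// ltW.
- by apply: measurable_funD => //; exact: measurable_funM.
- exact: integral_affine.
- rewrite le_eqVlt; apply/orP; left; apply/eqP.
  by rewrite /denom; field; rewrite !gt_eqF.
Qed.

(** The delay behind the depth 1 + y is L under every strategy once y exceeds m.
    Before, it is L under (A), 0 under (B), y L / m under (C), and under (D) it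
    is L exactly when u < y. *)
Lemma expected_time_right y : 0 < y <= M ->
  (expected_normalized_time strategy (pt RightArc y) <= V%:E)%E.
Proof.
move=> /andP[y0 yM]; have yl : 0 <= y <= M by rewrite ltW.
have L0 := L_gt0; have m0 := m_gt0; have mM := m_le_M.
have Lm0 : 0 < L + m by lra.
have LM0 : 0 <= L + y <= L + M by lra.
(* When L + y has been searched beyond the stem, at most L of it lies in the
   left arm. *)
have late left (lP : profile left) :
    (search_time (path_search lP) (pt RightArc y) <= (1 + (L + y))%:E)%E.
  apply: path_search_time_arm => //=.
  by have /andP[_] := profile_left lP LM0; lra.
case: (leP y m) => ym.
  apply: (@expected_time_le RightArc y (1 + (L + y)) (1 + y)
    (1 + y * (L + m) / m) ((1 + y) * m + L * y)
    (fun u => (1 + y) + L * \1_(`[0%R, y[%classic) u)) => //=.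
  - by lra.
  - exact: late.
  - apply: path_search_time_arm => //=; first by lra.
    by rewrite /right_left_right -/m (max_r (_ : y - m <= 0))
         ?min_l ?subr0 ?subr_le0// ltW.
  - have yLm : y * (L + m) / m <= L + m.
      by rewrite ler_pdivrMr// mulrC ler_wpM2l// ltW.
    apply: path_search_time_arm => //=.
      rewrite divr_ge0 ?mulr_ge0 ?(ltW y0) ?(ltW Lm0) ?(ltW m0)//=.
      by apply: le_trans yLm _; lra.
    rewrite /simultaneous -/m min_l// le_eqVlt; apply/orP; left; apply/eqP.
    by field; rewrite !gt_eqF.
  - move=> u um; rewrite indicE; case: (boolP (u \in _)) => uy.
      by rewrite mulr1 (_ : 1 + y + L = 1 + (L + y)) ?late//; ring.
    move: uy; rewrite mulr0 addr0 notin_setE/= in_itv/=.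
    have /andP[-> um'] := um; move=> /negP; rewrite -leNgt => yu.
    apply: path_search_time_arm => //=; first by lra.
    by rewrite clamp_id// /right_left_right (max_r (_ : y - u <= 0))
         ?min_l ?subr0 ?subr_le0// ltW.
  - by apply: measurable_funD => //; exact: measurable_funM.
  - by apply: integral_step; [lra|exact: ltW|rewrite ltW].
  - rewrite le_eqVlt; apply/orP; left; apply/eqP.
    by rewrite /denom; field; rewrite gt_eqF.
have mL : m ^+ 2 = L * (L + 2) by apply: Mclip_sqr => //; exact: lt_le_trans yM.
apply: (@expected_time_le RightArc y (1 + (L + y)) (1 + (L + y))
    (1 + (L + y)) ((1 + (L + y)) * m) (fun=> 1 + (L + y))) => //=.
- by lra.
1-3: exact: late.
- by move=> u um; exact: late.
- by rewrite (integral_cst _ _ (1 + (L + y))%:E)//=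
       lebesgue_measure_itv/= lte_fin m_gt0 oppr0 adde0.
- rewrite mulfK ?gt_eqF// [leLHS](_ : _ = denom * (1 + (L + y))); last first.
    by rewrite /denom; ring.
  have -> : denom = 2 * m * (1 + m) by rewrite /denom -mL; ring.
  have : 0 <= L * m * (y - m) by rewrite !mulr_ge0 ?subr_ge0// ltW.
  by nra.
Qed.

Lemma strategy_ratio_le : (randomized_ratio strategy <= V%:E)%E.
Proof.
apply: ge_ereal_sup => _ [H _ <-].
case: (pt_cases H) => -[t tl ->]; [|exact: expected_time_left|
  exact: expected_time_right].
move: tl => /andP[]; rewrite [0 <= t]le_eqVlt => /predU1P[<- _|t0 t1]; last first.
  by apply: expected_time_stem; rewrite t0.
have -> : pt Stem 0 = origin Q by rewrite /pt arcpt_le0.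
rewrite /expected_normalized_time /normalized_time eqxx integral0 lee_fin.
exact: le_trans V_ge1.
Qed.

(** * Every randomized search has ratio at least V *)

(** The image of A under the coordinate of the arm e is an interval that contains
    0 and 1 + y. Every value in it other than 1 is attained at a single point of
    the network; the centre, at value 1, is left out because the other arm has
    the same coordinate. *)
Lemma connected_arm (A : set (netpoint Q)) e y : e != Stem ->
  0 < y <= Ylen L M e -> connected A -> A (origin Q) -> A (pt e y) ->
  (forall s, 0 < s < 1 -> A (pt Stem s)) /\
  (forall s, 0 < s < y -> A (pt e s)).
Proof.
move=> eS /andP[y0 yl] cA AO Ay.
have iA : is_interval (arm_coord e @` A).
  apply/connected_intervalP/connected_continuous_connected => //.
  exact/continuous_subspaceT/arm_coord_continuous.
have mid s : 0 <= s <= 1 + y -> exists2 p, A p & arm_coord e p = s.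
  move=> hs; apply: (iA 0 (1 + y)) hs; first by exists (origin Q).
  exists (pt e y) => //; rewrite arm_coord_pt ?(ltW y0)//.
  by case: (e) eS => //= _; rewrite eqxx.
have pE t : arm_pos e e t = 1 + t by case: (e) eS => //= _; rewrite eqxx.
have coordP s p : A p -> arm_coord e p = s -> 0 < s -> s != 1 ->
    (s < 1 -> A (pt Stem s)) /\ (1 < s -> A (pt e (s - 1))).
  move=> Ap ps s0 s1.
  have arm e' z : e' != Stem -> 0 < z <= Ylen L M e' -> p = pt e' z ->
      (s < 1 -> A (pt Stem s)) /\ (1 < s -> A (pt e (s - 1))).
    move=> e'S /andP[z0 zl] pz; move: ps; rewrite pz arm_coord_pt ?(ltW z0)//.
    have [ee'|ee'] := eqVneq e' e.
      rewrite ee' pE => sz; split=> [?|_]; first by exfalso; lra.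
      by rewrite -sz addrAC subrr add0r -ee' -pz.
    move=> /esym sE; move: s1; rewrite sE; move: e'S ee'.
    by case: (e') => //= _ /negbTE ->; rewrite eqxx.
  case: (pt_cases p) => -[z zl pz];
    [|exact: (arm LeftArc z)|exact: (arm RightArc z)].
  move: ps; rewrite pz arm_coord_pt// => /= zs.
  split=> [_|?]; first by move: Ap; rewrite pz zs.
  by exfalso; case/andP: zl; lra.
split=> s /andP[s0 s1].
  have [|p Ap ps] := mid s; first by lra.
  by have [|h _] := coordP _ _ Ap ps s0; [rewrite lt_eqF|exact: h].
have [|p Ap ps] := mid (1 + s); first by lra.
have [||_ h] := coordP _ _ Ap ps; [by lra|by rewrite gt_eqF// ltrDl|].
by move: h; rewrite addrAC subrr add0r; apply; rewrite ltrDl.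
Qed.

Lemma lebesgue_ge (A : set R) (a b : R) : 0 <= a -> a <= b ->
  (forall s, 0 < s < a -> A s) ->
  (a%:E <= lebesgue_measure (`[0%R, b]%classic `&` A))%E.
Proof.
move=> a0 ab h.
have -> : a%:E = lebesgue_measure (`]0%R, a[%classic : set R).
  rewrite lebesgue_measure_itv/= lte_fin.
  by case: ltgtP a0 => // [_|<-]; rewrite ?sube0.
(* The set A need not be measurable: monotonicity of the outer measure is what
   is used. *)
apply: le_mu_ext => s /=; rewrite !in_itv/= => /[dup] /h As /andP[s0 sa].
by split=> //; rewrite (ltW s0) (le_trans _ ab)// ltW.
Qed.

(** The crux of the lower bound: the searched set is connected and has length t,
    so whatever it has gained on the arms was paid for by as much time, after
    time 1 for the stem. *)
Lemma searched_length_ge S t (a b : R) : 0 <= t <= 1 + L + M ->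
  0 <= a <= L -> 0 <= b <= M -> 0 < a + b ->
  (0 < a -> exists2 y, a <= y <= L & S t (pt LeftArc y)) ->
  (0 < b -> exists2 y, b <= y <= M & S t (pt RightArc y)) ->
  1 + a + b <= t.
Proof.
move=> /andP[t0 tm] /andP[a0 aL] /andP[b0 bM] ab Ha Hb.
have tm' : (t%:E <= length_measure [set: netpoint Q])%E.
  by rewrite length_net lee_fin.
have cS : connected (S t) by exact: searched_connected.
have SO : S t (origin Q).
  by apply: (searched_mono (lexx 0) t0 tm'); rewrite searched0.
have HL s : 0 < s < a -> S t (pt LeftArc s).
  move=> /andP[s0 sa]; have [y /andP[ay yL] Sy] := Ha (lt_trans s0 sa).
  have [||_ +] := connected_arm (e := LeftArc) _ _ cS SO Sy => //=; first by lra.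
  by apply; lra.
have HR s : 0 < s < b -> S t (pt RightArc s).
  move=> /andP[s0 sb]; have [y /andP[by_ yM] Sy] := Hb (lt_trans s0 sb).
  have [||_ +] := connected_arm (e := RightArc) _ _ cS SO Sy => //=; first by lra.
  by apply; lra.
have HS s : 0 < s < 1 -> S t (pt Stem s).
  have [a1|a1] := ltP 0 a.
    have [y /andP[ay yL] Sy] := Ha a1.
    have [||+ _] := connected_arm (e := LeftArc) _ _ cS SO Sy => //=; first by lra.
    exact.
  have b1 : 0 < b by lra.
  have [y /andP[by_ yM] Sy] := Hb b1.
  have [||+ _] := connected_arm (e := RightArc) _ _ cS SO Sy => //=; first by lra.
  exact.
rewrite -lee_fin -(searched_length S t0 tm') length_measureE !EFinD.
by apply: leeD; [apply: leeD|]; apply: lebesgue_ge.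
Qed.

(** The hiding points: n + 1 equally spaced points in each of the left arm and
    the first m units of the right arm, each carrying the length of its cell and
    placed at the far end of it, so that reaching the point means having searched
    the cell. *)
Section Grid.
Variable n : nat.
Let I := (bool * 'I_n.+1)%type.

Let arc (b : bool) : Yarc := if b then LeftArc else RightArc.
Let width (b : bool) : R := if b then L else m.
Let N : R := n.+1%:R.

Let N_gt0 : 0 < N. Proof. by rewrite ltr0n. Qed.
Let width_gt0 b : 0 < width b. Proof. by case: b. Qed.

Definition grid_pos (i : I) : R := width i.1 * (i.2.+1%:R / N).
Definition grid_pt (i : I) : netpoint Q := pt (arc i.1) (grid_pos i).
Definition grid_weight (i : I) : R := width i.1 / N.

Lemma grid_pos_range i : 0 < grid_pos i <= width i.1.
Proof.
rewrite /grid_pos mulr_gt0 ?divr_gt0 ?ltr0n//= -[leRHS]mulr1 ler_pM2l//.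
by rewrite ler_pdivrMr// mul1r ler_nat ltn_ord.
Qed.

Lemma grid_pos_in_arc i : 0 < grid_pos i <= Ylen L M (arc i.1).
Proof.
have /andP[-> h] := grid_pos_range i; apply: le_trans h _.
by case: i => -[].
Qed.

Lemma grid_weight_ge0 i : 0 <= grid_weight i.
Proof. by rewrite divr_ge0// ltW. Qed.

Lemma big_grid (P : pred I) (F : I -> R) :
  \sum_(i | P i) F i = \sum_(k | P (true, k)) F (true, k) +
                       \sum_(k | P (false, k)) F (false, k).
Proof.
transitivity (\sum_(b : bool) \sum_(k | P (b, k)) F (b, k)).
  rewrite (pair_big_dep xpredT (fun b k => P (b, k)) (fun b k => F (b, k)))/=.
  by apply: eq_big => [[]|[]].
by rewrite big_bool.
Qed.

(** Among the points of an arm that are reached, one is at least as far as their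
    total weight; the search has covered the arm up to that point. *)
Lemma grid_time_ge S t (J : pred I) i0 : 0 <= t <= 1 + L + M -> J i0 ->
  (forall i, J i -> S t (grid_pt i)) ->
  1 + \sum_(i | J i) grid_weight i <= t.
Proof.
move=> tr Ji0 HJ; rewrite big_grid addrA.
pose A b : {set 'I_n.+1} := [set k | J (b, k)]%SET.
have sumE b : \sum_(k | J (b, k)) grid_weight (b, k) = width b * (#|A b|%:R / N).
  transitivity (\sum_(k in A b) grid_weight (b, k)).
    by apply: eq_bigl => k; rewrite inE.
  by rewrite /grid_weight/= sumr_const -[LHS]mulr_natr mulrA mulrAC.
have sum_ge0 b : 0 <= \sum_(k | J (b, k)) grid_weight (b, k).
  by apply: sumr_ge0 => k _; exact: grid_weight_ge0.
have sum_le b : \sum_(k | J (b, k)) grid_weight (b, k) <= width b.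
  rewrite sumE -[leRHS]mulr1 ler_pM2l// ler_pdivrMr// mul1r ler_nat.
  by rewrite -[leqRHS](card_ord n.+1) max_card.
have far b : 0 < \sum_(k | J (b, k)) grid_weight (b, k) ->
    exists2 y, \sum_(k | J (b, k)) grid_weight (b, k) <= y <= Ylen L M (arc b)
      & S t (pt (arc b) y).
  move=> s0; have /exists_card_le_ord[k] : (0 < #|A b|)%N.
    by rewrite lt0n; apply/eqP => c0; move: s0; rewrite sumE c0 mul0r mulr0 ltxx.
  rewrite inE => Jk ck; exists (grid_pos (b, k)); last exact: HJ Jk.
  have /andP[_ ->] := grid_pos_in_arc (b, k); rewrite andbT sumE /grid_pos/=.
  by rewrite ler_pM2l// ler_pM2r ?invr_gt0// ler_nat.
apply: (@searched_length_ge S) => //.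
- by rewrite sum_ge0 sum_le.
- by rewrite sum_ge0 (le_trans (sum_le false)).
- have pos b : (0 < #|A b|)%N -> 0 < \sum_(k | J (b, k)) grid_weight (b, k).
    by move=> c; rewrite sumE mulr_gt0// divr_gt0// ltr0n.
  case: i0 Ji0 => -[] k Jk.
  + by rewrite ltr_pwDl// pos//; apply/card_gt0P; exists k; rewrite inE.
  + by rewrite ltr_pwDr// pos//; apply/card_gt0P; exists k; rewrite inE.
- exact: far true.
- exact: far false.
Qed.

(** The infimum that defines a search time need not be attained, and the points
    found no later than the i-th one may be approached at different times; the
    maximum of these finitely many times exceeds the search time of the i-th
    point by less than any given eps. *)
Lemma grid_rank S i :
  ((1 + \sum_(j | (search_time S (grid_pt j) <= search_time S (grid_pt i))%E)
     grid_weight j)%:E <= search_time S (grid_pt i))%E.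
Proof.
have T0 := search_time_ge0 S (grid_pt i).
case Ti : (search_time S (grid_pt i)) T0 => [T| |] // T0; last exact: leey.
apply/lee_addgt0Pr => eps eps0; rewrite -EFinD lee_fin.
rewrite lee_fin in T0; have M0 := M_gt0; have L0 := L_gt0.
have /choice[tau htau] j : exists t, [/\ 0 <= t, t <= 1 + L + M, t < T + eps &
    (search_time S (grid_pt j) <= T%:E)%E -> S t (grid_pt j)].
  case: (boolP (search_time S (grid_pt j) <= T%:E)%E) => Tj; last first.
    by exists 0; split=> //; lra.
  have /ereal_inf_lt[_ [t [t0 tm St] <-] tT] :
      (search_time S (grid_pt j) < (T + eps)%:E)%E.
    by apply: le_lt_trans Tj _; rewrite lte_fin ltrDl.
  by exists t; split=> //; rewrite -lee_fin -(length_net).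
pose t := \big[Num.max/0]_j tau j.
have t0 : 0 <= t by exact: bigmax_ge_id.
have tm : t <= 1 + L + M.
  by apply: bigmax_le => [|j _]; [lra|case: (htau j)].
have tT : t < T + eps.
  by apply: bigmax_lt => [|j _]; [lra|case: (htau j)].
apply: (le_trans _ (ltW tT)).
apply: (@grid_time_ge S t _ i) => [|//|j Tj]; [by rewrite t0|by rewrite Ti|].
have [tau0 _ _ /(_ Tj) Sj] := htau j.
have := searched_mono (e := S) tau0 (le_bigmax 0 tau j).
by apply => //; rewrite length_net lee_fin.
Qed.

Lemma sum_grid_weight : \sum_i grid_weight i = L + m.
Proof.
have N0 := lt0r_neq0 N_gt0.
have E x : x / N *+ n.+1 = x by rewrite -[LHS]mulr_natr divfK.
by rewrite big_grid /grid_weight/= !sumr_const !card_ord !E.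
Qed.

Lemma sum_grid_depth : \sum_i grid_weight i * (1 + grid_pos i) =
  denom / 2 + (L ^+ 2 + m ^+ 2) / 2 / N.
Proof.
have N0 := lt0r_neq0 N_gt0.
have side b : \sum_k grid_weight (b, k) * (1 + grid_pos (b, k)) =
    width b + width b ^+ 2 * (N + 1) / 2 / N.
  rewrite /grid_weight/grid_pos/= -mulr_sumr big_split/= sumr_const card_ord.
  by rewrite -[1 *+ n.+1]/N -mulr_sumr -mulr_suml sum_succ -/N; field.
by rewrite big_grid !side /= /denom -/m; field.
Qed.

Lemma sum_grid_time_ge S :
  ((L + m + (L + m) ^+ 2 / 2)%:E <=
   \sum_i (grid_weight i)%:E * search_time S (grid_pt i))%E.
Proof.
by rewrite -sum_grid_weight; apply: sum_rank_ge; [exact: grid_weight_ge0|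
  exact: grid_rank].
Qed.

(** Each normalized search time is multiplied by weight times depth, which turns
    it into a weighted search time; the expectation commutes with the finite
    sum. *)
Lemma randomized_grid (s : randomized_search Q) :
  ((L + m + (L + m) ^+ 2 / 2)%:E <=
   randomized_ratio s * (denom / 2 + (L ^+ 2 + m ^+ 2) / 2 / N)%:E)%E.
Proof.
have d0 i : 0 < 1 + grid_pos i.
  by have /andP[p0 _] := grid_pos_range i; rewrite addr_gt0.
have g0 i : 0 <= grid_weight i * (1 + grid_pos i).
  by rewrite mulr_ge0 ?grid_weight_ge0// ltW.
rewrite -sum_grid_depth muleC.
pose f i (S : search_space (base_search s)) :=
  ((grid_weight i * (1 + grid_pos i))%:E * normalized_time S (grid_pt i))%E.
have nE i S : normalized_time S (grid_pt i) =
    (search_time S (grid_pt i) * (1 + grid_pos i)^-1%:E)%E.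
  have pi_arc : 0 <= grid_pos i <= Ylen L M (arc i.1).
    by have /andP[/ltW -> ->] := grid_pos_in_arc i.
  have dE : depth (arc i.1) (grid_pos i) = 1 + grid_pos i by case: (i) => -[].
  have nO : (grid_pt i == origin Q) = false.
    apply/eqP => /(pt_origin pi_arc); rewrite dE => d1.
    by move: (d0 i); rewrite d1 ltxx.
  by rewrite /normalized_time nO /grid_pt (root_dist_pt pi_arc) dE.
have fE i S : f i S = ((grid_weight i)%:E * search_time S (grid_pt i))%E.
  by rewrite /f nE muleCA -EFinM mulfK ?lt0r_neq0// muleC.
have mf i : measurable_fun [set: search_space (base_search s)] (f i).
  apply: measurable_funeM; exact: normalized_time_measurable.
have f0 i S : [set: search_space (base_search s)] S -> (0 <= f i S)%E.
  by move=> _; rewrite fE mule_ge0 ?search_time_ge0// lee_fin grid_weight_ge0.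
apply: (@le_trans _ _ (\int[law s]_(S in [set: search_space (base_search s)])
    (L + m + (L + m) ^+ 2 / 2)%:E)%E).
  by rewrite (integral_cst _ _ (L + m + (L + m) ^+ 2 / 2)%:E)//
       [X in (_ * X)%E](@probability_setT _ _ _ (law s)) mule1.
apply: (@le_trans _ _ (\int[law s]_(S in [set: search_space (base_search s)])
    \sum_i f i S)%E).
  apply: ge0_le_integral => //.
  - by move=> S _; rewrite lee_fin !addr_ge0// ?divr_ge0 ?sqr_ge0// ltW.
  - exact: emeasurable_sum.
  - move=> S _; under eq_bigr do rewrite fE; exact: sum_grid_time_ge.
rewrite ge0_integral_sum// -sumEFin ge0_sume_distrl; last first.
  by move=> i _; rewrite lee_fin.
apply: lee_sum => i _; rewrite /f ge0_integralZl//.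
- apply: lee_wpmul2l; first by rewrite lee_fin.
  by apply: ereal_sup_ubound; exists (grid_pt i).
- exact: normalized_time_measurable.
- by move=> S _; rewrite nE mule_ge0 ?search_time_ge0// lee_fin invr_ge0 ltW.
- by rewrite lee_fin.
Qed.
End Grid.

Lemma randomized_ratio_ge (s : randomized_search Q) :
  (V%:E <= randomized_ratio s)%E.
Proof.
have L0 := L_gt0; have m0 := m_gt0; have D0 := denom_gt0.
have VD : V * denom / 2 = L + m + (L + m) ^+ 2 / 2.
  by rewrite /V mulrDl divfK ?lt0r_neq0// mul1r /denom -/m; field.
have Kn n : 0 < denom / 2 + (L ^+ 2 + m ^+ 2) / 2 / n.+1%:R.
  by rewrite addr_gt0 ?divr_gt0// addr_gt0 ?exprn_gt0.
have W0 : 0 < L + m + (L + m) ^+ 2 / 2.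
  by rewrite addr_gt0 ?divr_gt0 ?exprn_gt0 ?addr_gt0.
have := randomized_grid ^~ s; case: (randomized_ratio s) => [r| |] h.
- rewrite lee_fin leNgt; apply/negP => rV.
  have r0 : 0 <= r.
    have := h 0%N; rewrite -EFinM lee_fin => /(lt_le_trans W0).
    by rewrite pmulr_lgt0// => /ltW.
  (* If r < V, then delta > 0 while the inequality on the grid bounds it by K
     over the number of points per arm, for every such number. *)
  pose K := r * ((L ^+ 2 + m ^+ 2) / 2).
  pose delta := (V - r) * denom / 2.
  have d0 : 0 < delta by rewrite /delta divr_gt0// mulr_gt0// subr_gt0.
  have K0 : 0 <= K by rewrite mulr_ge0// divr_ge0// addr_ge0// sqr_ge0.
  have := archi_boundP (divr_ge0 K0 (ltW d0)); set n := Num.bound _ => Kb.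
  have := h n; rewrite -EFinM lee_fin -VD leNgt => /negP; apply.
  rewrite mulrDr -ltrBrDl.
  have -> : V * denom / 2 - r * (denom / 2) = delta by rewrite /delta; field.
  rewrite mulrA -/K ltr_pdivrMr// mulrC -ltr_pdivrMr//.
  by apply: lt_trans Kb _; rewrite ltr_nat.
- exact: leey.
- by have := h 0%N; rewrite mulNyr gtr0_sg ?Kn// mul1e leeNy_eq.
Qed.
End YNetwork.

Unset Implicit Arguments.
Set Strict Implicit.

Theorem mainTheorem7 (R : realType) (L M : R) (L_gt0 : 0 < L) (LM : L <= M) :
  let Q := Ynet L_gt0 LM in
  let M' := Mclip L M in
  let D := L * (L + 2) + M' * (M' + 2) in
  let V := 1 + 2 * L * M' / D in
  competitive_ratio Q = V%:E /\
  exists (SA SB SC : expanding_search Q) (SD : R -> expanding_search Q)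
         (s : randomized_search Q),
    let X := search_space (base_search s) in
    [/\ [/\ follows SA (left_then_right L),
            follows SB (right_left_right L M'),
            follows SC (simultaneous L M') &
            forall u, 0 <= u <= M' -> follows (SD u) (right_left_right L u)],
        measurable_fun [set: measurableTypeR R]
          (SD : measurableTypeR R -> X),
        (forall A : set X, measurable A ->
           s A = ((2 * M' / D)%:E * \d_(SA : X) A
                + ((L ^+ 2 + 2 * L - M' ^+ 2) / D)%:E * \d_(SB : X) A
                + (2 * L ^+ 2 / D)%:E * \d_(SC : X) A
                + ((2 * M' ^+ 2 - 2 * L ^+ 2) / D)%:E
                  * uniform_prob (Mclip_gt0 L_gt0 LM) (SD @^-1` A))%E),
        optimal_search s &
        randomized_ratio s = V%:E].
Proof.
move=> Q M' D V; pose s := strategy L_gt0 LM.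
have ratioE : randomized_ratio s = V%:E.
  by apply/le_anti; rewrite randomized_ratio_ge strategy_ratio_le.
have valueE : competitive_ratio Q = V%:E.
  apply/le_anti/andP; split.
    by rewrite -ratioE; apply: ereal_inf_lbound; exists s.
  by apply: le_ereal_inf_tmp => _ [s' _ <-]; exact: randomized_ratio_ge.
split=> //.
exists (searchA L_gt0 LM), (searchB L_gt0 LM), (searchC L_gt0 LM).
exists (searchD L_gt0 LM), s; split.
- by split; [exact: path_search_follows..|exact: searchD_follows].
- exact: searchD_measurable.
- by move=> A _; exact: mixture_lawE.
- by rewrite /optimal_search ratioE valueE.
- exact: ratioE.
Qed.
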